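(* Let $(A,\sigma)$ be a Hermitian algebra and $G=\mathrm{Sp}_2(A_\mathbb{C},\sigma_\mathbb{C})$. Let $F_{\mathfrak{C}_G,\mathfrak{P}_G^\pm}\colon\mathfrak{C}_G\to\mathfrak{P}_G^\pm$ be the map sending a quaternionic structure $J$ to the $A_\mathbb{H}$-line $l_J^\pm=yA_\mathbb{H}$, where $y\in A_\mathbb{H}^2$ is regular with $J_\mathbb{H}(y)=\mp yj$. Let $J\in\mathfrak{C}_G$, $L\in T_J\mathfrak{C}_G$, and let $x$ be a generator of $l_J^\pm$ with $J_\mathbb{H}(x)=\mp xj$. Then $$d_JF_{\mathfrak{C}_G,\mathfrak{P}_G^\pm}(L)=\left[x,\pm\tfrac12L_\mathbb{H}(x)j+l_J^\pm\right]=\pm\tfrac12[L_\mathbb{H}(\bullet)]j\in T_{l_J^\pm}\mathfrak{P}_G^\pm,$$ where $[L_\mathbb{H}(\bullet)]\colon l_J^\pm\to A_\mathbb{H}^2/l_J^\pm$ denotes the projection of the restriction $L_\mathbb{H}|_{l_J^\pm}\colon l_J^\pm\to A_\mathbb{H}^2$.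
   Context: $A$ is a unital associative, possibly noncommutative, finite-dimensional semisimple $\mathbb{R}$-algebra and $\sigma\colon A\to A$ is an anti-involution: $\mathbb{R}$-linear, $\sigma(ab)=\sigma(b)\sigma(a)$, $\sigma^2=\mathrm{Id}$. For any involutive algebra $(B,\tau)$ put $B^\tau=\{a\in B\mid\tau(a)=a\}$, $B^\times$ the group of invertible elements, $\mathrm{O}(B,\tau)=\{a\in B^\times\mid \tau(a)=a^{-1}\}$, $B^\tau_+=\{a^2\mid a\in B^\tau\cap B^\times\}$, $B^\tau_-=-B^\tau_+$, $B^\tau_{\ge 0}=\{a^2\mid a\in B^\tau\}$. The pair $(A,\sigma)$ is Hermitian if for $x,y\in A^\sigma$, $x^2+y^2=0$ implies $x=y=0$; as standing properties of Hermitian algebras, $A^\sigma_+$ and $A^\sigma_{\ge0}$ are proper convex cones in $A^\sigma$, $\mathrm{O}(A,\sigma)$ is compact, and $x\mapsto ax\sigma(a)$ preserves $A^\sigma_+$ and $A^\sigma_{\geq 0}$ for every $a\in A^\times$. $A_\mathbb{C}=A\otimes_\mathbb{R}\mathbb{C}\{i\}\subset A_\mathbb{H}=A\otimes_\mathbb{R}\mathbb{H}\{i,j,k\}$, $ij=-ji=k$; every element of $A_\mathbb{H}$ is uniquely $x+yj$ with $x,y\in A_\mathbb{C}$. $\sigma_\mathbb{C},\bar\sigma_\mathbb{C}$ are the $\mathbb{C}$-linear and $\mathbb{C}$-antilinear extensions of $\sigma$ to $A_\mathbb{C}$. Anti-involutions on $A_\mathbb{H}$: $\sigma_0(x+yj)=\sigma_\mathbb{C}(x)+\bar\sigma_\mathbb{C}(y)j$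 and $\sigma_1(x+yj)=\bar\sigma_\mathbb{C}(x)-\sigma_\mathbb{C}(y)j$. For $B=A_\mathbb{C}$ or $A_\mathbb{H}$, $B^2$ is the right $B$-module of columns; $x\in B^2$ is regular if there is $y\in B^2$ such that $(a,b)\mapsto xa+yb$ is an isomorphism $B^2\to B^2$; a $B$-line is $xB$ with $x$ regular. Let $\omega_\mathbb{C}(x,y)=\sigma_\mathbb{C}(x)^t\begin{pmatrix}0&1\\-1&0\end{pmatrix}y$ on $A_\mathbb{C}^2$; $\mathrm{Sp}_2(A_\mathbb{C},\sigma_\mathbb{C})$ is the group of $A_\mathbb{C}$-linear automorphisms preserving it. On $A_\mathbb{H}^2$ let $\omega_\mathbb{H}(x,y)=\sigma_0(x)^t\begin{pmatrix}0&1\\-1&0\end{pmatrix}y$ and $h(x,y)=\sigma_1(x)^t\begin{pmatrix}0&j\\-j&0\end{pmatrix}y$. A quaternionic structure on $A_\mathbb{C}^2$ is an additive $J$ with $J^2=-\mathrm{Id}$ and $J(xa)=J(x)\bar a$ for $a\in A_\mathbb{C}$. $\mathfrak{C}_G$ is the set of quaternionic structures $J$ such that $h_J(x,y)=\omega_\mathbb{C}(J(x),y)$ is a $\bar\sigma_\mathbb{C}$-inner product, i.e. $h_J(x,y)=\bar\sigma_\mathbb{C}(h_J(y,x))$ and for all regular $x$, $h_J(x,x)\in(A_\mathbb{C}^{\bar\sigma_\mathbb{C}})_{\ge0}$ with $h_J(x,x)=0$ iff $x=0$. It is a smooth manifold, homogeneous under conjugation by $G$; tangent vectors $L\in T_J\mathfrak{C}_G$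 are additive maps $A_\mathbb{C}^2\to A_\mathbb{C}^2$ with $L(xa)=L(x)\bar a$ (and satisfying $LJ+JL=0$). For $M=J$ or $L$, the extension to $A_\mathbb{H}^2=A_\mathbb{C}^2\oplus A_\mathbb{C}^2j$ is $M_\mathbb{H}(u+vj)=M(u)+M(v)j$; the map $x\mapsto M_\mathbb{H}(x)j$ is right $A_\mathbb{H}$-linear. $\mathfrak{P}_G^\pm=\{xA_\mathbb{H}\mid x\in A_\mathbb{H}^2\text{ regular},\ \omega_\mathbb{H}(x,x)=0,\ h(x,x)\in(A_\mathbb{H}^{\sigma_1})_\pm\}$, an open subset of the manifold of $\omega_\mathbb{H}$-isotropic $A_\mathbb{H}$-lines. Its tangent space at $l=xA_\mathbb{H}$ is $\{Q\in\mathrm{Hom}_{A_\mathbb{H}}(l,A_\mathbb{H}^2/l)\mid\omega_\mathbb{H}(Q(x),x)\in A_\mathbb{H}^{\sigma_0}\}$; $[x,w]$ denotes the map $xa\mapsto wa$ (the velocity of $x(t)A_\mathbb{H}$ if $x(0)=x$, $\dot x(0)+l=w$). *)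

(* Defs.v *)
From HB Require Import structures.
From mathcomp Require Import all_boot all_order all_algebra all_field.
From mathcomp Require Import all_classical all_reals all_analysis.

Set Implicit Arguments.
Unset Strict Implicit.
Unset Printing Implicit Defensive.

Import Order.TTheory GRing.Theory Num.Theory.
Import numFieldNormedType.Exports.

Local Open Scope classical_set_scope.
Local Open Scope ring_scope.

(* The regular right module is semisimple: every right ideal (an R-subspace,
   as A is unital) has a complementary right ideal. *)
Definition semisimple (R : realType) (A : falgType R) : Prop :=
  forall U : {vspace A}, (U * fullv <= U)%VS ->
  exists W : {vspace A},
    [/\ (W * fullv <= W)%VS, (U + W)%VS = fullv & (U :&: W)%VS = 0%VS].

Definition anti_involution (R : realType) (A : falgType R)
    (s : {linear A -> A}) : Prop :=
  (forall a b, s (a * b) = s b * s a) /\ (forall a, s (s a) = a).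

Section Cones.
Variables (B : unitRingType) (t : B -> B).

Definition sym : set B := [set a | t a = a].
Definition sym_pos : set B :=
  [set a | exists b, [/\ sym b, b \is a GRing.unit & a = b ^+ 2]].
Definition sym_neg : set B := [set a | sym_pos (- a)].
Definition sym_ge0 : set B := [set a | exists2 b, sym b & a = b ^+ 2].

(* [false] stands for the sign +, [true] for the sign -, as in (-1) ^+ b. *)
Definition sym_sign (b : bool) : set B := if b then sym_neg else sym_pos.

End Cones.

Definition hermitian_algebra (R : realType) (A : falgType R)
    (s : {linear A -> A}) : Prop :=
  forall x y : A, sym s x -> sym s y -> x ^+ 2 + y ^+ 2 = 0 -> x = 0 /\ y = 0.

Fact lin_bij_vect_axiom (R : nzRingType) (V : lmodType R) (W : vectType R)
    (f : V -> W) : linear f -> bijective f -> Vector.axiom (vector.dim W) V.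
Proof.
move=> f_lin f_bij; case: (@vector_subdef _ W) => g [gZ gD] g_bij.
exists (g \o f); last exact: bij_comp.
by move=> k x y; rewrite /= f_lin gD gZ.
Qed.

(* A_C, with [MkC a b] = a + b i. *)
Record cplx (R : realType) (A : falgType R) : Type := MkC { reC : A; imC : A }.
Arguments MkC {R A}.

Section Complexification.
Variables (R : realType) (A : falgType R).
Implicit Types x y z : cplx A.

Definition pair_of_cplx x : A * A := (reC x, imC x).
Definition cplx_of_pair (p : A * A) : cplx A := MkC p.1 p.2.

Fact pair_of_cplxK : cancel pair_of_cplx cplx_of_pair. Proof. by case. Qed.
Fact cplx_of_pairK : cancel cplx_of_pair pair_of_cplx. Proof. by case. Qed.

HB.instance Definition _ := Choice.copy (cplx A) (can_type pair_of_cplxK).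

Definition cplx_add x y := MkC (reC x + reC y) (imC x + imC y).
Definition cplx_opp x := MkC (- reC x) (- imC x).

Fact cplx_addA : associative cplx_add.
Proof. by move=> x y z; congr MkC; apply: addrA. Qed.
Fact cplx_addC : commutative cplx_add.
Proof. by move=> x y; congr MkC; apply: addrC. Qed.
Fact cplx_add0 : left_id (MkC 0 0) cplx_add.
Proof. by move=> [a b]; congr MkC; apply: add0r. Qed.
Fact cplx_addN : left_inverse (MkC 0 0) cplx_opp cplx_add.
Proof. by move=> x; congr MkC; apply: addNr. Qed.
HB.instance Definition _ :=
  GRing.isZmodule.Build (cplx A) cplx_addA cplx_addC cplx_add0 cplx_addN.

Definition cplx_scale (k : R) x := MkC (k *: reC x) (k *: imC x).

Fact cplx_scaleA k l x : cplx_scale k (cplx_scale l x) = cplx_scale (k * l) x.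
Proof. by congr MkC; apply: scalerA. Qed.
Fact cplx_scale1 : left_id 1 cplx_scale.
Proof. by move=> [a b]; congr MkC; apply: scale1r. Qed.
Fact cplx_scaleDr : right_distributive cplx_scale +%R.
Proof. by move=> k x y; congr MkC; apply: scalerDr. Qed.
Fact cplx_scaleDl x : {morph cplx_scale^~ x : k l / k + l}.
Proof. by move=> k l; congr MkC; apply: scalerDl. Qed.
HB.instance Definition _ := GRing.Zmodule_isLmodule.Build R (cplx A)
  cplx_scaleA cplx_scale1 cplx_scaleDr cplx_scaleDl.

Fact pair_of_cplx_linear : linear pair_of_cplx. Proof. by []. Qed.
HB.instance Definition _ := Lmodule_hasFinDim.Build R (cplx A)
  (lin_bij_vect_axiom pair_of_cplx_linear
     (Bijective pair_of_cplxK cplx_of_pairK)).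

Definition cplx_mul x y : cplx A :=
  MkC (reC x * reC y - imC x * imC y) (reC x * imC y + imC x * reC y).

Fact cplx_mulA : associative cplx_mul.
Proof.
move=> x y z; congr MkC => /=;
  rewrite !(mulrDl, mulrDr, mulNr, mulrN, opprD) !mulrA !addrA;
  by rewrite [LHS]addrAC; congr (_ + _); rewrite addrAC.
Qed.
Fact cplx_mul1 : left_id (MkC 1 0) cplx_mul.
Proof. by move=> [a b]; rewrite /cplx_mul /= !mul1r !mul0r subr0 addr0. Qed.
Fact cplx_mulr1 : right_id (MkC 1 0) cplx_mul.
Proof. by move=> [a b]; rewrite /cplx_mul /= !mulr1 !mulr0 subr0 add0r. Qed.
Fact cplx_mulDl : left_distributive cplx_mul +%R.
Proof. by move=> x y z; congr MkC; rewrite /= !mulrDl ?opprD addrACA. Qed.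
Fact cplx_mulDr : right_distributive cplx_mul +%R.
Proof. by move=> x y z; congr MkC; rewrite /= !mulrDr ?opprD addrACA. Qed.
Fact cplx_one_neq0 : MkC 1 0 != 0 :> cplx A.
Proof. by apply/eqP => /(congr1 (@reC R A)) /eqP; rewrite oner_eq0. Qed.
HB.instance Definition _ := GRing.Zmodule_isNzRing.Build (cplx A)
  cplx_mulA cplx_mul1 cplx_mulr1 cplx_mulDl cplx_mulDr cplx_one_neq0.

Fact cplx_scaleAl (k : R) x y : k *: (x * y) = (k *: x) * y.
Proof. by congr MkC; rewrite /= (scalerBr, scalerDr) -!scalerAl. Qed.
HB.instance Definition _ :=
  GRing.Lmodule_isLalgebra.Build R (cplx A) cplx_scaleAl.
Fact cplx_scaleAr (k : R) x y : k *: (x * y) = x * (k *: y).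
Proof. by congr MkC; rewrite /= (scalerBr, scalerDr) -!scalerAr. Qed.
HB.instance Definition _ :=
  GRing.Lalgebra_isAlgebra.Build R (cplx A) cplx_scaleAr.
HB.instance Definition _ := Algebra_isFalgebra.Build R (cplx A).

Definition conj_cplx x : cplx A := MkC (reC x) (- imC x).

Fact conj_cplxK : involutive conj_cplx.
Proof. by move=> [a b]; rewrite /conj_cplx /= opprK. Qed.
Fact conj_cplxD x y : conj_cplx (x + y) = conj_cplx x + conj_cplx y.
Proof. by congr MkC; rewrite /= opprD. Qed.
Fact conj_cplxN x : conj_cplx (- x) = - conj_cplx x.
Proof. by []. Qed.
Fact conj_cplxM x y : conj_cplx (x * y) = conj_cplx x * conj_cplx y.
Proof. by congr MkC; rewrite /= ?mulrNN // opprD mulrN mulNr. Qed.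
Fact conj_cplxZ (k : R) x : conj_cplx (k *: x) = k *: conj_cplx x.
Proof. by congr MkC; rewrite /= scalerN. Qed.
Fact conj_cplx0 : conj_cplx 0 = 0.
Proof. by congr MkC; rewrite oppr0. Qed.
Fact conj_cplx1 : conj_cplx 1 = 1.
Proof. by congr MkC; rewrite oppr0. Qed.

End Complexification.

(* A_H, with [MkH x y] = x + y j; the product follows from j x = conj_cplx x * j
   and j ^ 2 = -1. *)
Record quat (R : realType) (A : falgType R) : Type :=
  MkH { fstH : cplx A; sndH : cplx A }.
Arguments MkH {R A}.

Section Quaternionification.
Variables (R : realType) (A : falgType R).
Implicit Types x y z : quat A.

Definition pair_of_quat x : cplx A * cplx A := (fstH x, sndH x).
Definition quat_of_pair (p : cplx A * cplx A) : quat A := MkH p.1 p.2.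

Fact pair_of_quatK : cancel pair_of_quat quat_of_pair. Proof. by case. Qed.
Fact quat_of_pairK : cancel quat_of_pair pair_of_quat. Proof. by case. Qed.

HB.instance Definition _ := Choice.copy (quat A) (can_type pair_of_quatK).

Definition quat_add x y := MkH (fstH x + fstH y) (sndH x + sndH y).
Definition quat_opp x := MkH (- fstH x) (- sndH x).

Fact quat_addA : associative quat_add.
Proof. by move=> x y z; congr MkH; apply: addrA. Qed.
Fact quat_addC : commutative quat_add.
Proof. by move=> x y; congr MkH; apply: addrC. Qed.
Fact quat_add0 : left_id (MkH 0 0) quat_add.
Proof. by move=> [a b]; congr MkH; apply: add0r. Qed.
Fact quat_addN : left_inverse (MkH 0 0) quat_opp quat_add.
Proof. by move=> x; congr MkH; apply: addNr. Qed.
HB.instance Definition _ :=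
  GRing.isZmodule.Build (quat A) quat_addA quat_addC quat_add0 quat_addN.

Definition quat_scale (k : R) x := MkH (k *: fstH x) (k *: sndH x).

Fact quat_scaleA k l x : quat_scale k (quat_scale l x) = quat_scale (k * l) x.
Proof. by congr MkH; apply: scalerA. Qed.
Fact quat_scale1 : left_id 1 quat_scale.
Proof. by move=> [a b]; congr MkH; apply: scale1r. Qed.
Fact quat_scaleDr : right_distributive quat_scale +%R.
Proof. by move=> k x y; congr MkH; apply: scalerDr. Qed.
Fact quat_scaleDl x : {morph quat_scale^~ x : k l / k + l}.
Proof. by move=> k l; congr MkH; apply: scalerDl. Qed.
HB.instance Definition _ := GRing.Zmodule_isLmodule.Build R (quat A)
  quat_scaleA quat_scale1 quat_scaleDr quat_scaleDl.

Fact pair_of_quat_linear : linear pair_of_quat. Proof. by []. Qed.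
HB.instance Definition _ := Lmodule_hasFinDim.Build R (quat A)
  (lin_bij_vect_axiom pair_of_quat_linear
     (Bijective pair_of_quatK quat_of_pairK)).

Definition quat_mul x y : quat A :=
  MkH (fstH x * fstH y - sndH x * conj_cplx (sndH y))
      (fstH x * sndH y + sndH x * conj_cplx (fstH y)).

Fact quat_mulA : associative quat_mul.
Proof.
move=> x y z; congr MkH => /=;
  rewrite !(conj_cplxD, conj_cplxN, conj_cplxM, conj_cplxK);
  rewrite !(mulrDl, mulrDr, mulNr, mulrN, opprD) !mulrA !addrA;
  by rewrite [LHS]addrAC; congr (_ + _); rewrite addrAC.
Qed.
Fact quat_mul1 : left_id (MkH 1 0) quat_mul.
Proof. by move=> [a b]; rewrite /quat_mul /= !mul1r !mul0r subr0 addr0. Qed.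
Fact quat_mulr1 : right_id (MkH 1 0) quat_mul.
Proof.
move=> [a b]; rewrite /quat_mul /= conj_cplx0 conj_cplx1.
by rewrite !mulr1 !mulr0 subr0 add0r.
Qed.
Fact quat_mulDl : left_distributive quat_mul +%R.
Proof. by move=> x y z; congr MkH; rewrite /= !mulrDl ?opprD addrACA. Qed.
Fact quat_mulDr : right_distributive quat_mul +%R.
Proof.
by move=> x y z; congr MkH; rewrite /= conj_cplxD !mulrDr ?opprD addrACA.
Qed.
Fact quat_one_neq0 : MkH 1 0 != 0 :> quat A.
Proof. by apply/eqP => /(congr1 (@fstH R A)) /eqP; rewrite oner_eq0. Qed.
HB.instance Definition _ := GRing.Zmodule_isNzRing.Build (quat A)
  quat_mulA quat_mul1 quat_mulr1 quat_mulDl quat_mulDr quat_one_neq0.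

Fact quat_scaleAl (k : R) x y : k *: (x * y) = (k *: x) * y.
Proof. by congr MkH; rewrite /= (scalerBr, scalerDr) -!scalerAl. Qed.
HB.instance Definition _ :=
  GRing.Lmodule_isLalgebra.Build R (quat A) quat_scaleAl.
Fact quat_scaleAr (k : R) x y : k *: (x * y) = x * (k *: y).
Proof. by congr MkH; rewrite /= conj_cplxZ (scalerBr, scalerDr) -!scalerAr. Qed.
HB.instance Definition _ :=
  GRing.Lalgebra_isAlgebra.Build R (quat A) quat_scaleAr.
HB.instance Definition _ := Algebra_isFalgebra.Build R (quat A).

Definition jH : quat A := MkH 0 1.

End Quaternionification.
Arguments jH {R A}.

Section Involutions.
Variables (R : realType) (A : falgType R) (s : {linear A -> A}).

Definition sC (x : cplx A) : cplx A := MkC (s (reC x)) (s (imC x)).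
Definition sCbar (x : cplx A) : cplx A := MkC (s (reC x)) (- s (imC x)).

Definition s0 (x : quat A) : quat A := MkH (sC (fstH x)) (sCbar (sndH x)).
Definition s1 (x : quat A) : quat A := MkH (sCbar (fstH x)) (- sC (sndH x)).

End Involutions.

(* Columns of length 2 are pairs; B acts on the right, entrywise. *)
Section Lines.
Variables (R : realType) (B : falgType R).
Implicit Types x y v : B * B.

Definition scal x (a : B) : B * B := (x.1 * a, x.2 * a).

Definition regular x : Prop :=
  exists y, bijective (fun ab : B * B => scal x ab.1 + scal y ab.2).

Definition line x : set (B * B) := [set v | exists a, v = scal x a].

(* The class w + l, and the map [x, w + l] : xa |-> wa + l on l = xB (it takes
   the value [set0] off xB). Maps l -> B^2 / l are coded as functions
   B^2 -> set (B^2) whose values on l are classes modulo l. *)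
Definition coset_mod (l : set (B * B)) (w : B * B) : set (B * B) :=
  [set w + z | z in l].

Definition bracket x (w : B * B) (v : B * B) : set (B * B) :=
  [set u | exists a, v = scal x a /\ coset_mod (line x) (scal w a) u].

(* Q restricts to an element of Hom_B(l, B^2 / l). *)
Definition is_hom (l : set (B * B)) (Q : B * B -> set (B * B)) : Prop :=
  [/\ forall v, l v -> exists w, Q v = coset_mod l w,
      forall v v' w w', l v -> l v' ->
        Q v = coset_mod l w -> Q v' = coset_mod l w' ->
        Q (v + v') = coset_mod l (w + w')
    & forall v w a, l v ->
        Q v = coset_mod l w -> Q (scal v a) = coset_mod l (scal w a)].

End Lines.

Section QuaternionicStructures.
Variables (R : realType) (A : falgType R) (s : {linear A -> A}).

Local Notation VC := (cplx A * cplx A)%type.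
Local Notation VH := (quat A * quat A)%type.

Definition omegaC (x y : VC) : cplx A := sC s x.1 * y.2 - sC s x.2 * y.1.
Definition omegaH (x y : VH) : quat A := s0 s x.1 * y.2 - s0 s x.2 * y.1.
Definition hH (x y : VH) : quat A := s1 s x.1 * jH * y.2 - s1 s x.2 * jH * y.1.

Definition antilinear (M : 'End(VC)) : Prop :=
  forall (x : VC) (a : cplx A), M (scal x a) = scal (M x) (conj_cplx a).

(* Additive maps satisfying [antilinear] are R-linear, so nothing is lost by
   taking J in the finite-dimensional space of R-linear endomorphisms. *)
Definition quaternionic (J : 'End(VC)) : Prop :=
  antilinear J /\ (forall x, J (J x) = - x).

Definition hJ (J : 'End(VC)) (x y : VC) : cplx A := omegaC (J x) y.

Definition inner_product (h : VC -> VC -> cplx A) : Prop :=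
  (forall x y, h x y = sCbar s (h y x)) /\
  (forall x, regular x ->
     sym_ge0 (sCbar s) (h x x) /\ (h x x = 0 <-> x = 0)).

Definition CG : set 'End(VC) :=
  [set J | quaternionic J /\ inner_product (hJ J)].

(* M_H (u + v j) = M u + M v j. *)
Definition extH (M : 'End(VC)) (x : VH) : VH :=
  let u := M (fstH x.1, fstH x.2) in
  let v := M (sndH x.1, sndH x.2) in
  (MkH u.1 v.1, MkH u.2 v.2).

Definition PG (b : bool) : set (set VH) :=
  [set l | exists x, [/\ regular x, omegaH x x = 0,
                         sym_sign (s1 s) b (hH x x) & l = line x]].

(* T_l P_G^b; the condition does not depend on the generator x of l, nor on
   the representative w of Q(x). *)
Definition tangentP (l : set VH) (Q : VH -> set VH) : Prop :=
  is_hom l Q /\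
  (forall x w, l = line x -> Q x w -> sym (s0 s) (omegaH w x)).

End QuaternionicStructures.

(* Curves in a finite-dimensional real vector space are differentiated through
   all linear forms, i.e. coordinatewise in any basis. *)
Section Curves.
Variables (R : realType) (V : vectType R).

Definition smooth_near0 (c : R -> V) : Prop :=
  \forall t \near (0 : R), forall (phi : {linear V -> R^o}) (n : nat),
    derivable (derive1n n (fun u : R => phi (c u) : R^o)) t 1.

Definition has_velocity (c : R -> V) (v : V) : Prop :=
  forall phi : {linear V -> R^o},
    is_derive (0 : R) (1 : R) (fun u : R => phi (c u) : R^o) (phi v).

End Curves.

Section Differential.
Variables (R : realType) (A : falgType R) (s : {linear A -> A}).

Local Notation VC := (cplx A * cplx A)%type.
Local Notation VH := (quat A * quat A)%type.

(* c is, near 0, a smooth curve in the submanifold C_G of the space of R-linear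
   endomorphisms, with c(0) = J and c'(0) = L. *)
Definition curve_through (J L : 'End(VC)) (c : R -> 'End(VC)) : Prop :=
  [/\ smooth_near0 c, \forall t \near (0 : R), CG s (c t),
      c 0 = J & has_velocity c L].

Definition tangentC (J L : 'End(VC)) : Prop := exists c, curve_through J L c.

Definition is_lift (l : R -> set VH) (y : R -> VH) : Prop :=
  smooth_near0 y /\
  \forall t \near (0 : R), regular (y t) /\ l t = line (y t).

(* The curve of lines l is smooth near 0 with velocity Q at 0: it lifts to a
   smooth curve y of regular elements, and Q = [y(0), y'(0) + l(0)] for every
   such lift. *)
Definition line_velocity (l : R -> set VH) (Q : VH -> set VH) : Prop :=
  (exists y, is_lift l y) /\
  (forall y w, is_lift l y -> has_velocity y w ->
     forall v, l 0 v -> Q v = bracket (y 0) w v).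

(* d_J F (L) = Q. *)
Definition is_differential (F : 'End(VC) -> set VH) (J L : 'End(VC))
    (Q : VH -> set VH) : Prop :=
  tangentC J L /\ (forall c, curve_through J L c -> line_velocity (F \o c) Q).

End Differential.

(* Main.v *)
Require Import Defs.
From HB Require Import structures.
From mathcomp Require Import all_boot all_order all_algebra all_field.
From mathcomp Require Import all_classical all_reals all_analysis.

(* K_M : v |-> M_H(v) j is right A_H-linear, K_J is an involution, and left
   multiplication by i anticommutes with it.  Hence, with e = +1 or -1 the sign
   of P_G, F J is the whole e-eigenspace of K_J, and (1 + e K_(c t)) / 2 applied
   to a generator of F J is a smooth lift of F (c t); its regularity for small t
   is the non-vanishing of a determinant.  Differentiating K_(c t) y(t) = e y(t)
   along an arbitrary lift shows y'(0) = (e/2) K_L y(0) modulo F J, and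
   differentiating omega_H(y(t), y(t)) = 0 gives the symmetry condition defining
   the tangent space of P_G. *)

Set Implicit Arguments.
Unset Strict Implicit.
Unset Printing Implicit Defensive.

Import Order.TTheory GRing.Theory Num.Theory.
Import numFieldNormedType.Exports.
Import VectorInternalTheory.

Local Open Scope classical_set_scope.
Local Open Scope ring_scope.

(** * Linear forms and injectivity in finite-dimensional real spaces *)

Section LinearMaps.
Variable R : realType.
Implicit Types V W : vectType R.

Definition pack_linear V W (f : V -> W) (f_lin : linear f) : {linear V -> W} :=
  HB.pack f (GRing.isLinear.Build R V W *:%R f f_lin).

(** Smoothness and velocity are tested on linear forms, so a linear map acts on curves by pulling
    forms back. *)
Lemma comp_form V W (f : V -> W) (f_lin : linear f)
    (phi : {linear W -> R^o}) :
  exists psi : {linear V -> R^o}, forall v, psi v = phi (f v).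
Proof. by exists (phi \o pack_linear f_lin). Qed.

Lemma v2r_form V (j : 'I_(vector.dim V)) :
  exists phi : {linear V -> R^o}, forall v,
    phi v = v2r v 0 j.
Proof.
have f_lin : linear (fun v : V => v2r v 0 j : R^o).
  by move=> k u v; rewrite /= linearP !mxE.
by exists (pack_linear f_lin).
Qed.

(** Coordinates are themselves linear forms. *)
Lemma form_inj V (u v : V) :
  (forall phi : {linear V -> R^o}, phi u = phi v) -> u = v.
Proof.
move=> uv; apply: v2r_inj; apply/rowP => j.
by have [phi phiE] := v2r_form j; rewrite -!phiE.
Qed.

Lemma linear_inj_bij V (f : V -> V) : linear f -> injective f -> bijective f.
Proof.
move=> f_lin f_inj; pose g := linfun (pack_linear f_lin).
have gE : g =1 f by move=> v; rewrite lfunE.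
have g0 : lker g == 0%VS by apply/lker0P => u v; rewrite !gE => /f_inj.
exists (g^-1)%VF => v; rewrite -gE; first exact: lker0_lfunK.
exact: lker0_lfunVK.
Qed.

(* Over a basis, injectivity is the non-vanishing of a determinant, which is a
   continuous function of the matrix entries. *)
Lemma near_injective V (T : R -> V -> V) :
    (forall t, linear (T t)) ->
    (forall v (phi : {linear V -> R^o}),
       {for (0 : R), continuous (fun t : R => phi (T t v) : R^o)}) ->
    injective (T 0) ->
  \forall t \near (0 : R), injective (T t).
Proof.
move=> T_lin T_cont T0_inj.
pose M t := lin1_mx (v2r \o pack_linear (T_lin t) \o
                     r2v).
have ME t v : v2r v *m M t = v2r (T t v).
  by rewrite mul_rV_lin1 /= v2rK.
have M0 : \det (M 0) != 0.
  rewrite -unitfE -[_ \is a _]/(M 0 \in unitmx) -row_free_unit.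
  apply: inj_row_free => u; rewrite -[u]r2vK ME => Tu0.
  have: T 0 (r2v u) = T 0 0.
    apply: v2r_inj; rewrite Tu0.
    by rewrite -[T 0 0]/(pack_linear (T_lin 0) 0) !linear0.
  by move/T0_inj->; rewrite linear0.
have entry_cont i k : M t i k @[t --> (0 : R)] --> M 0 i k.
  have [phi phiE] := v2r_form k.
  have MikE t : M t i k = phi (T t (r2v (delta_mx 0 i))).
    by rewrite phiE -ME r2vK -rowE [RHS]mxE.
  rewrite MikE (_ : (fun t => M t i k) =
    fun t => phi (T t (r2v (delta_mx 0 i)))); first exact: T_cont.
  by apply/funext => t; rewrite MikE.
have det_cont : \det (M t) @[t --> (0 : R)] --> \det (M 0).
  rewrite /determinant; apply: (@cvg_big _ _ +%R) => [|p _].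
    exact: add_continuous.
  apply: cvgM; first exact: cvg_cst.
  apply: (@cvg_big R _ (@GRing.mul R) 1 xpredT) => [|i _].
    exact: mul_continuous.
  exact: entry_cont.
have : \forall t \near (0 : R), \det (M t) != 0.
  exact: (cvgr_neq0 _ det_cont M0).
apply: filterS => t Mt u v Tuv.
have Mt_free : row_free (M t) by rewrite row_free_unit unitmxE unitfE.
apply: v2r_inj; apply: (row_free_inj Mt_free).
by rewrite /= !ME Tuv.
Qed.

End LinearMaps.

(** * Calculus of velocities and smooth curves *)

Section Velocities.
Variable R : realType.
Implicit Types V W U : vectType R.

(** Besides uniqueness, this is the tool for differentiating an identity valid for [t] near 0: the
    velocities of its two sides must agree. *)
Lemma has_velocity_uniq V (c d : R -> V) v w :
    has_velocity c v -> has_velocity d w ->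
    (\forall t \near (0 : R), c t = d t) ->
  v = w.
Proof.
move=> cv dw cd; apply: form_inj => phi.
have d_phi : is_derive (0 : R) (1 : R) (fun u : R => phi (c u) : R^o) (phi w).
  apply: near_eq_is_derive (dw phi).
  by apply: filterS cd => t ->.
rewrite -(@derive_val _ _ _ _ _ _ _ (cv phi)).
by rewrite (@derive_val _ _ _ _ _ _ _ d_phi).
Qed.

Lemma has_velocity_cst V (v : V) : has_velocity (fun=> v) 0.
Proof. by move=> phi; rewrite linear0; exact: is_derive_cst. Qed.

Lemma has_velocityD V (c d : R -> V) v w :
  has_velocity c v -> has_velocity d w ->
  has_velocity (fun t => c t + d t) (v + w).
Proof.
move=> cv dw phi; rewrite linearD.
rewrite (_ : (fun _ => _) =
  (fun t : R => phi (c t) : R^o) + (fun t : R => phi (d t) : R^o)).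
  exact: is_deriveD.
by apply/funext => t; rewrite linearD.
Qed.

Lemma has_velocity_linear V W (f : V -> W) (c : R -> V) v :
  linear f -> has_velocity c v -> has_velocity (f \o c) (f v).
Proof.
move=> f_lin cv phi; have [psi psiE] := comp_form f_lin phi.
rewrite -psiE (_ : (fun _ => _) = (fun t : R => psi (c t) : R^o)) //.
by apply/funext => t; rewrite psiE.
Qed.

(** Product rule. Expanding the first argument in a basis turns [phi (B (c t) (d t))] into a finite
    sum of products of real functions. *)
Lemma has_velocity_bilinear V W U (B : V -> W -> U) (c : R -> V) (d : R -> W)
    v w :
    (forall y, linear (B^~ y)) -> (forall x, linear (B x)) ->
    has_velocity c v -> has_velocity d w ->
  has_velocity (fun t => B (c t) (d t)) (B v (d 0) + B (c 0) w).
Proof.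
move=> Bl Br cv dw phi.
pose e := r2v \o delta_mx (0 : 'I_1) : _ -> V.
have BE x y : phi (B x y) =
    \sum_i v2r x 0 i * phi (B (e i) y).
  have [psi psiE] := comp_form (Bl y) phi.
  rewrite -psiE -[x in LHS]v2rK.
  rewrite [v2r x in LHS]row_sum_delta !linear_sum /=.
  by apply: eq_bigr => i _; rewrite !linearZ /= psiE.
have dE i : is_derive (0 : R) (1 : R)
    (fun t : R => v2r (c t) 0 i * phi (B (e i) (d t)) : R^o)
    (v2r v 0 i * phi (B (e i) (d 0)) +
     v2r (c 0) 0 i * phi (B (e i) w)).
  have [p pE] := v2r_form i; have [q qE] := comp_form (Br (e i)) phi.
  rewrite -!pE -!qE.
  rewrite (_ : (fun _ => _) =
    (fun t : R => p (c t) : R^o) * (fun t : R => q (d t) : R^o)); last first.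
    by apply/funext => t; rewrite -pE -qE.
  have := is_deriveM (cv p) (dw q).
  by rewrite addrC [q (d 0) *: _]mulrC.
rewrite (_ : (fun _ => _) = \sum_i (fun t : R =>
    v2r (c t) 0 i * phi (B (e i) (d t)) : R^o)).
  have := is_derive_sum dE.
  by rewrite big_split linearD /= -!BE.
by apply/funext => t; rewrite BE fct_sumE.
Qed.

(** The constant cancels in every difference quotient, so the first derivatives are limits of the
    same function. *)
Lemma derive1n_cstD (k : R) (f : R -> R^o) n :
  derive1n n.+1 (fun t => k + f t : R^o) = derive1n n.+1 f.
Proof.
rewrite !derive1Sn; congr (derive1n n _); apply/funext => t.
rewrite /derive1; set F := (X in X @ _); set G := (X in _ = lim (X @ _)).
suff -> : F = G by []; apply/funext => h; rewrite /F /G.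
by rewrite opprD addrACA subrr add0r.
Qed.

Lemma smooth_near0_affine V W (f : V -> W) (w : W) (c : R -> V) :
  linear f -> smooth_near0 c -> smooth_near0 (fun t => w + f (c t)).
Proof.
move=> f_lin; apply: filterS => t c_smooth phi n.
have [psi psiE] := comp_form f_lin phi.
rewrite (_ : (fun _ => _) = (fun u : R => phi w + psi (c u) : R^o)); last first.
  by apply/funext => u; rewrite linearD psiE.
(* Order 0 concerns the function itself, where the constant is still present; from order 1 on it has
   disappeared. *)
case: n => [|n]; last by rewrite derive1n_cstD; exact: c_smooth.
by apply: derivableD; [exact: derivable_cst | exact: (c_smooth psi 0)].
Qed.

Lemma smooth_near0_continuous V (c : R -> V) (phi : {linear V -> R^o}) :
  smooth_near0 c -> {for (0 : R), continuous (fun t : R => phi (c t) : R^o)}.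
Proof.
move=> /nbhs_singleton /(_ phi 0%N) /derivable1_diffP.
exact: differentiable_continuous.
Qed.

End Velocities.

(** * Lines and their quotients over a right module of columns *)

Section RightModule.
Variables (R : realType) (B : falgType R).
Implicit Types (x y z v w : B * B) (a b : B).

Lemma scal_linearl a : linear (fun x : B * B => scal x a).
Proof.
by move=> k x y; congr (_, _); rewrite /= mulrDl -scalerAl.
Qed.

Lemma scal_linearr x : linear (scal x).
Proof. by move=> k a b; congr (_, _); rewrite /= mulrDr scalerAr. Qed.

Lemma scalBl x y a : scal (x - y) a = scal x a - scal y a.
Proof. by congr (_, _); rewrite mulrBl. Qed.

Lemma scalDr x a b : scal x (a + b) = scal x a + scal x b.
Proof. by congr (_, _); rewrite mulrDr. Qed.

Lemma scalBr x a b : scal x (a - b) = scal x a - scal x b.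
Proof. by congr (_, _); rewrite mulrBr. Qed.

Lemma scalZl (k : R) x a : scal (k *: x) a = k *: scal x a.
Proof. by congr (_, _); rewrite -scalerAl. Qed.

Lemma scalA x a b : scal (scal x a) b = scal x (a * b).
Proof. by congr (_, _); rewrite mulrA. Qed.

Lemma scal1 x : scal x 1 = x.
Proof. by case: x => x1 x2; congr (_, _); rewrite mulr1. Qed.

Lemma scal0 x : scal x 0 = 0.
Proof. by congr (_, _); rewrite mulr0. Qed.

Definition frame x y (ab : B * B) : B * B := scal x ab.1 + scal y ab.2.

Lemma frame_linear x y : linear (frame x y).
Proof.
move=> k [a1 a2] [b1 b2]; rewrite /frame /= !scal_linearr.
by rewrite scalerDr addrACA.
Qed.

Lemma regular_inj x : regular x -> injective (scal x).
Proof.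
move=> [y /bij_inj xy_inj] a b xab.
have := xy_inj (a, 0) (b, 0); rewrite /= !scal0 !addr0 => /(_ xab).
by case.
Qed.

Lemma line_id x : line x x.
Proof. by exists 1; rewrite scal1. Qed.

Lemma lineD x v w : line x v -> line x w -> line x (v + w).
Proof. by move=> [a ->] [b ->]; exists (a + b); rewrite scalDr. Qed.

Lemma lineB x v w : line x v -> line x w -> line x (v - w).
Proof. by move=> [a ->] [b ->]; exists (a - b); rewrite scalBr. Qed.

Lemma line_scal x v a : line x v -> line x (scal v a).
Proof. by move=> [b ->]; exists (b * a); rewrite scalA. Qed.

Lemma coset_line_eqP x v w :
  coset_mod (line x) v = coset_mod (line x) w <-> line x (v - w).
Proof.
have x0 : line x 0 by exists 0; rewrite scal0.
split=> [vw | xvw].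
  have : coset_mod (line x) w v by rewrite -vw; exists 0; rewrite ?addr0.
  by move=> [z xz <-]; rewrite addrC addKr.
apply/seteqP; split=> _ [z xz <-].
  by exists (v - w + z); [exact: lineD | rewrite addrA [w + _]addrC subrK].
exists (z - (v - w)); first exact: lineB.
by rewrite opprB [z + _]addrC addrA addrC [v + _]addrC subrK addrC.
Qed.

(** [bracket] allows any coefficient [a] with [v = scal x a]. The hypothesis makes all of them give
    the class of [W v], so the value is well defined. *)
Lemma bracketE x w (W : B * B -> B * B) v :
    (forall a, line x (scal w a - W (scal x a))) -> line x v ->
  bracket x w v = coset_mod (line x) (W v).
Proof.
move=> wW [a ->]; apply/seteqP; split=> [u [b [-> wbu]] | u Wu].
  by move/coset_line_eqP: (wW b) => <-.
by exists a; split=> //; move/coset_line_eqP: (wW a) => ->.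
Qed.

Lemma is_hom_coset x (Q : B * B -> set (B * B)) (W : B * B -> B * B) :
    (forall v w, W (v + w) = W v + W w) ->
    (forall v a, W (scal v a) = scal (W v) a) ->
    (forall v, line x v -> Q v = coset_mod (line x) (W v)) ->
  is_hom (line x) Q.
Proof.
move=> WD Wscal QE; split=> [v /QE Qv | v v' w w' xv xv' Qv Qv' | v w a xv Qv].
- by exists (W v).
- rewrite QE; last exact: lineD.
  apply/coset_line_eqP; rewrite WD opprD addrACA.
  by apply: lineD; apply/coset_line_eqP; rewrite -QE.
- rewrite QE; last exact: line_scal.
  apply/coset_line_eqP; rewrite Wscal -scalBl.
  by apply: line_scal; apply/coset_line_eqP; rewrite -QE.
Qed.

End RightModule.

(** * The operator K_M and its eigenvectors *)

Section QuaternionicExtension.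
Variables (R : realType) (A : falgType R).
Local Notation VC := (cplx A * cplx A)%type.
Local Notation VH := (quat A * quat A)%type.
Implicit Types (M J : 'End(VC)) (v y : VH) (a : quat A) (e : R).

Definition KH M v : VH := scal (extH M v) jH.

Lemma jHE (p q : cplx A) : MkH p q * jH = MkH (- q) p.
Proof.
by congr MkH; rewrite /= ?conj_cplx0 ?conj_cplx1 ?mulr0 !mulr1 ?sub0r ?addr0.
Qed.

Lemma KHE M v :
  KH M v = (MkH (- (M (sndH v.1, sndH v.2)).1) (M (fstH v.1, fstH v.2)).1,
            MkH (- (M (sndH v.1, sndH v.2)).2) (M (fstH v.1, fstH v.2)).2).
Proof. by congr (_, _); exact: jHE. Qed.

Lemma KH_linear M : linear (KH M).
Proof.
move=> k u v; rewrite -scal_linearl; congr (scal _ jH).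
rewrite /extH /=.
set u1 := (fstH u.1, _); set u2 := (sndH u.1, _).
set v1 := (fstH v.1, _); set v2 := (sndH v.1, _).
rewrite (_ : (k *: fstH _ + _, _) = k *: u1 + v1) //.
by rewrite (_ : (k *: sndH _ + _, _) = k *: u2 + v2) // !linearP.
Qed.

Lemma KH_linearl v : linear (fun M => KH M v).
Proof.
move=> k M N; rewrite -scal_linearl; congr (scal _ jH).
by rewrite /extH !add_lfunE !scale_lfunE.
Qed.

Lemma KHZ M (k : R) v : KH M (k *: v) = k *: KH M v.
Proof. exact: (linearZZ (pack_linear (KH_linear M))). Qed.

Lemma KHD M u v : KH M (u + v) = KH M u + KH M v.
Proof. exact: (linearD (pack_linear (KH_linear M))). Qed.

(** The conjugation coming from the antilinear [M] is undone by moving a complex scalar past j. *)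
Lemma KH_scal M v a : antilinear M -> KH M (scal v a) = scal (KH M v) a.
Proof.
move=> M_anti; pose p := fstH a; pose q := sndH a.
pose v1 : VC := (fstH v.1, fstH v.2); pose v2 : VC := (sndH v.1, sndH v.2).
rewrite !KHE.
have -> : (sndH (scal v a).1, sndH (scal v a).2) =
    scal v1 q + scal v2 (conj_cplx p) by [].
have -> : (fstH (scal v a).1, fstH (scal v a).2) =
    scal v1 p - scal v2 (conj_cplx q) by [].
rewrite [M (_ + _)]linearD [M (_ - _)]linearB /= !M_anti !conj_cplxK -/v1 -/v2.
by congr (_, _); congr MkH; rewrite /= mulNr ?opprD addrC.
Qed.

(** J_H commutes with right multiplication by j, and both square to -1. *)
Lemma KHK J v : quaternionic J -> KH J (KH J v) = v.
Proof.
move=> [_ JJ]; rewrite KHE (KHE J v) /=.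
set p : VC := (fstH v.1, _); set q : VC := (sndH v.1, _).
rewrite (_ : ((J p).1, (J p).2) = J p); last by case: (J p).
rewrite (_ : (- (J q).1, - (J q).2) = - J q); last by case: (J q).
rewrite linearN /= !JJ !opprK {}/p {}/q.
by case: v => [[? ?] [? ?]].
Qed.

(** Right multiplication by j turns the defining condition of the line into an eigenvector equation,
    as j squares to -1. *)
Lemma eigen_extH J e y :
  extH J y = (- e) *: scal y jH -> KH J y = e *: y.
Proof.
move=> Jy; rewrite /KH Jy scalZl scalA.
have -> : jH * jH = - 1 :> quat A by rewrite jHE; congr MkH; rewrite oppr0.
have -> : scal y (- 1) = - y.
  by case: y {Jy} => y1 y2; congr (_, _); rewrite mulrN1.
by rewrite scalerN scaleNr opprK.
Qed.

(* Left multiplication by i is right A_H-linear and anticommutes with KH M, so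
   it exchanges the two eigenspaces of KH J. *)
Definition iH : quat A := MkH (MkC 0 1) 0.
Definition theta v : VH := (iH * v.1, iH * v.2).

Lemma theta_scal v a : theta (scal v a) = scal (theta v) a.
Proof. by congr (_, _); rewrite mulrA. Qed.

Lemma iHE (p q : cplx A) : iH * MkH p q = MkH (MkC 0 1 * p) (MkC 0 1 * q).
Proof. by congr MkH; rewrite /= !mul0r (subr0, addr0). Qed.

Lemma iC_comm (p : cplx A) : MkC 0 1 * p = p * MkC 0 1.
Proof.
by congr MkC; rewrite /= !(mul0r, mulr0, mul1r, mulr1) ?(add0r, addr0).
Qed.

Lemma thetaE v : theta v =
  (MkH (MkC 0 1 * fstH v.1) (MkC 0 1 * sndH v.1),
   MkH (MkC 0 1 * fstH v.2) (MkC 0 1 * sndH v.2)).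
Proof. by case: v => [[p q] [p' q']]; congr (_, _); exact: iHE. Qed.

Lemma thetaK v : theta (theta v) = - v.
Proof.
have iK : iH * iH = - 1.
  rewrite iHE mulr0; congr MkH; rewrite ?oppr0 //.
  by congr MkC; rewrite /= !(mul0r, mulr0, mul1r) ?sub0r ?addr0 ?oppr0.
by case: v => v1 v2; congr (_, _); rewrite mulrA iK mulN1r.
Qed.

Lemma theta_linear : linear theta.
Proof. by move=> k u v; congr (_, _); rewrite /= mulrDr scalerAr. Qed.

Lemma thetaZ (k : R) v : theta (k *: v) = k *: theta v.
Proof. by congr (_, _); rewrite scalerAr. Qed.

Lemma theta0 : theta 0 = 0.
Proof. by congr (_, _); rewrite mulr0. Qed.

(** As i is central in A_C, on complex columns left multiplication by i is right multiplication by
    i, which [M] turns into right multiplication by -i. *)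
Lemma KH_theta M v : antilinear M -> KH M (theta v) = - theta (KH M v).
Proof.
move=> M_anti.
have Mi (p q : cplx A) :
    M (MkC 0 1 * p, MkC 0 1 * q) = scal (M (p, q)) (MkC 0 (- 1)).
  by rewrite !iC_comm -[(_, _)]/(scal (p, q) (MkC 0 1)) M_anti.
rewrite thetaE !KHE /= !Mi.
have conjiE (p : cplx A) : p * MkC 0 (- 1) = - (MkC 0 1 * p).
  by rewrite iC_comm -mulrN; congr (_ * _); congr MkC; rewrite oppr0.
rewrite thetaE -[RHS]/(- _, - _) /=.
by congr (_, _); congr MkH; rewrite /= !conjiE ?mulrN.
Qed.

(** * Eigenspaces of K_J as lines *)

Section Eigenspaces.
Variables (J : 'End(VC)) (e : R).
Hypotheses (J_quat : quaternionic J) (ee : e * e = 1).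

(** The term q = [scal (theta y) ab.2] lies in the (-e)-eigenspace. If its sum with an e-eigenvector
    is an e-eigenvector, then 2 e q = 0, and e is non-zero because [e * e = 1]. *)
Lemma eigen_frame y (ab : VH) :
    KH J y = e *: y ->
    KH J (frame y (theta y) ab) = e *: frame y (theta y) ab ->
  scal (theta y) ab.2 = 0.
Proof.
have [J_anti _] := J_quat.
move=> Jy; set q := scal (theta y) ab.2.
have Jq : KH J q = - (e *: q).
  by rewrite KH_scal // KH_theta // Jy thetaZ -scaleNr scalZl scaleNr.
rewrite /frame KHD KH_scal // Jy scalZl -/q Jq scalerDr => /addrI /eqP.
rewrite eq_sym -subr_eq0 opprK -mulr2n -scaler_nat scalerA scaler_eq0.
rewrite mulf_eq0 pnatr_eq0 /= => /orP[/eqP e0 | /eqP //].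
by have := oner_neq0 R; rewrite -ee e0 mul0r eqxx.
Qed.

(** This makes [y] regular, with [theta y] as the second column. *)
Lemma eigen_frame_bij y :
  injective (scal y) -> KH J y = e *: y -> bijective (frame y (theta y)).
Proof.
move=> y_inj Jy; apply: linear_inj_bij; first exact: frame_linear.
have zeroP a : scal y a = 0 -> a = 0 by rewrite -(scal0 y) => /y_inj.
have theta_inj : injective theta.
  by move=> u v uv; apply: oppr_inj; rewrite -!thetaK uv.
suff frame0 ab : frame y (theta y) ab = 0 -> ab = 0.
  move=> ab ab' abE; apply/eqP; rewrite -subr_eq0; apply/eqP/frame0.
  rewrite [LHS](linearB (pack_linear (frame_linear y (theta y)))) /=.
  by rewrite abE subrr.
(* The zero vector is an e-eigenvector, so the preceding lemma applies to an element of the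
   kernel. *)
move=> fab; have b0 : scal (theta y) ab.2 = 0.
  apply: eigen_frame => //; rewrite fab scaler0.
  exact: (linear0 (pack_linear (KH_linear J))).
move: fab; rewrite /frame b0 addr0 => /zeroP.
have /theta_inj/zeroP : theta (scal y ab.2) = theta 0.
  by rewrite theta_scal b0 theta0.
by case: ab {b0} => a b /= -> ->.
Qed.

(** For the inclusion of the eigenspace in the line, surjectivity of the frame writes v = y a + i y
    b, and the eigenvector equation kills the second term. *)
Lemma line_eigenE y :
    injective (scal y) -> KH J y = e *: y ->
  line y = [set v | KH J v = e *: v].
Proof.
have [J_anti _] := J_quat.
move=> y_inj Jy; apply/seteqP; split=> [_ [a ->] | v /= Jv].
  by rewrite /= KH_scal // Jy scalZl.
have [g _ fK] := eigen_frame_bij y_inj Jy.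
exists (g v).1; rewrite -[LHS]fK /frame eigen_frame ?addr0 //.
by rewrite fK.
Qed.

End Eigenspaces.

Lemma eigen_proj J e v : quaternionic J -> e * e = 1 ->
  let u := 2^-1 *: v + (e / 2) *: KH J v in KH J u = e *: u.
Proof.
move=> J_quat ee u; rewrite /u KHD !KHZ KHK // addrC scalerDr !scalerA mulrA ee.
by rewrite mul1r.
Qed.

End QuaternionicExtension.

(** * Sesquilinearity and skew-symmetry of omega_H *)

Section SymplecticForm.
Variables (R : realType) (A : falgType R) (s : {linear A -> A}).
Local Notation VH := (quat A * quat A)%type.
Implicit Types (p q : cplx A) (a b : quat A) (u v w x : VH).

Lemma s0_linear : linear (s0 s).
Proof.
move=> k a b; congr MkH; congr MkC; rewrite /= linearP //=.
by rewrite opprD scalerN.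
Qed.

Lemma s0B a b : s0 s (a - b) = s0 s a - s0 s b.
Proof. exact: (linearB (pack_linear s0_linear)). Qed.

Lemma omegaH_linearl y : linear (fun x => omegaH s x y).
Proof.
move=> k u v; rewrite /omegaH /= !s0_linear !mulrDl -!scalerAl.
by rewrite opprD addrACA scalerBr.
Qed.

Lemma omegaH_linearr x : linear (omegaH s x).
Proof.
move=> k u v; rewrite /omegaH /= !mulrDr -!scalerAr.
by rewrite opprD addrACA scalerBr.
Qed.

Hypothesis inv_s : anti_involution s.

Lemma s0K a : s0 s (s0 s a) = a.
Proof.
have [_ sK] := inv_s; case: a => [[a b] [c d]].
by rewrite /s0 /sC /sCbar /= linearN /= !sK opprK.
Qed.

Lemma s0M a b : s0 s (a * b) = s0 s b * s0 s a.
Proof.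
have [sM _] := inv_s; case: a b => [[a b] [c d]] [[a' b'] [c' d']].
have sN (r : A) : s (- r) = - s r by rewrite linearN.
have sD (r r' : A) : s (r + r') = s r + s r' by rewrite linearD.
congr MkH; congr MkC; rewrite /= !(sD, sN, sM);
  rewrite !(mulrN, mulNr, opprD, opprK) !addrA //.
- by rewrite addrAC [s b' * _ + _]addrC.
- by rewrite -[LHS]addrA addrC addrA.
- rewrite [LHS]addrC -!addrA; congr (_ + _).
  by rewrite addrC [- _ + _]addrC -addrA.
Qed.

Lemma omegaH_scal u v a b :
  omegaH s (scal u a) (scal v b) = s0 s a * omegaH s u v * b.
Proof. by rewrite /omegaH /= !s0M mulrBr mulrBl !mulrA. Qed.

(** With this sign, symmetry of omega_H(w, y) amounts to omega_H(w, y) + omega_H(y, w) = 0, the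
    derivative of the isotropy condition. *)
Lemma s0_omegaH u v : s0 s (omegaH s u v) = - omegaH s v u.
Proof. by rewrite /omegaH s0B !s0M !s0K opprB. Qed.

Lemma PG_isotropic (sgn : bool) l u v :
  PG s sgn l -> l u -> l v -> omegaH s u v = 0.
Proof.
move=> [x [_ xx _ ->]] [a ->] [c ->].
by rewrite omegaH_scal xx mulr0 mul0r.
Qed.

End SymplecticForm.

(** Antilinearity is the vanishing of maps linear in [M], so it passes from a curve to its
    velocity. *)
Lemma antilinear_velocity (R : realType) (A : falgType R)
    (c : R -> 'End((cplx A * cplx A)%type)) (L : 'End((cplx A * cplx A)%type)) :
    has_velocity c L -> (\forall t \near (0 : R), antilinear (c t)) ->
  antilinear L.
Proof.
move=> cL c_anti x a; apply/eqP; rewrite -subr_eq0; apply/eqP.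
pose f (M : 'End((cplx A * cplx A)%type)) :=
  M (scal x a) - scal (M x) (conj_cplx a).
have f_lin : linear f.
  move=> k M N; rewrite /f !add_lfunE !scale_lfunE scal_linearl.
  by rewrite scalerBr opprD addrACA.
apply: (has_velocity_uniq (has_velocity_linear f_lin cL) (has_velocity_cst 0)).
by apply: filterS c_anti => t ct; rewrite /= /f ct subrr.
Qed.

(** * Lifts of the curve of lines and their derivatives *)

Section Eigenlines.
Variables (R : realType) (A : falgType R) (s : {linear A -> A}).
Variables (b : bool) (e : R) (F : {fun CG s >-> PG s b}).
Hypotheses (ee : e * e = 1)
  (FE : forall J, CG s J -> exists y : quat A * quat A,
     [/\ regular y, extH J y = (- e) *: scal y jH & F J = line y]).
Implicit Types (J L : 'End((cplx A * cplx A)%type)) (v : quat A * quat A).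

(** This describes [F J] without a chosen generator, by an equation that can be differentiated in
    [J]. *)
Lemma eigenline J : CG s J ->
  F J = [set v | KH J v = e *: v] :> set (quat A * quat A).
Proof.
move=> CGJ; have [y [y_reg /eigen_extH Jy ->]] := FE CGJ.
have [J_quat _] := CGJ.
by rewrite (line_eigenE J_quat ee) //; exact: regular_inj.
Qed.

Lemma eigenline_isotropic J u v :
  anti_involution s -> CG s J -> F J u -> F J v -> omegaH s u v = 0.
Proof.
move=> inv_s CGJ; exact: (PG_isotropic inv_s (@funS _ _ _ _ F J CGJ)).
Qed.

Variables (J L : 'End((cplx A * cplx A)%type)).
Variable c : R -> 'End((cplx A * cplx A)%type).
Hypotheses (CGJ : CG s J) (cL : curve_through s J L c).

(** The projection onto the e-eigenspace applied to a fixed [v]. It is affine in [c t], so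
    smoothness and velocity are inherited from [c]. *)
Definition eigen_lift v t := 2^-1 *: v + (e / 2) *: KH (c t) v.

Lemma eigen_lift0 v : F J v -> eigen_lift v 0 = v.
Proof.
have [_ _ c0 _] := cL; rewrite eigenline //= /eigen_lift c0 => ->.
rewrite scalerA mulrAC ee -scalerDl div1r.
by rewrite -[LHS]scale1r scalerA mul1r -[2^-1]mul1r -splitr scale1r.
Qed.

Lemma eigen_lift_mem v : \forall t \near (0 : R), F (c t) (eigen_lift v t).
Proof.
have [_ c_CG _ _] := cL; apply: filterS c_CG => t CGt.
by rewrite eigenline //=; apply: eigen_proj => //; case: CGt.
Qed.

Lemma eigen_lift_smooth v : smooth_near0 (eigen_lift v).
Proof.
have [c_smooth _ _ _] := cL.
apply: (@smooth_near0_affine _ _ _ (fun M => (e / 2) *: KH M v)) => //.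
by move=> k M N; rewrite KH_linearl scalerDr !scalerA [e / 2 * k]mulrC.
Qed.

Lemma eigen_lift_velocity v :
  has_velocity (eigen_lift v) ((e / 2) *: KH L v).
Proof.
have [_ _ _ cv] := cL; rewrite -[X in has_velocity _ X]add0r.
apply: has_velocityD; first exact: has_velocity_cst.
apply: (@has_velocity_linear _ _ _ (fun M => (e / 2) *: KH M v)) => //.
by move=> k M N; rewrite KH_linearl scalerDr !scalerA [e / 2 * k]mulrC.
Qed.

Lemma eigen_lift_is_lift y : injective (scal y) -> F J y ->
  is_lift (F \o c) (eigen_lift y).
Proof.
move=> y_inj Fy; split; first exact: eigen_lift_smooth.
have y0 := eigen_lift0 Fy.
have T_near : \forall t \near (0 : R),
    injective (frame (eigen_lift y t) (theta (eigen_lift y t))).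
  apply: near_injective => [t|ab phi|]; first exact: frame_linear.
    (* Both columns of the frame depend linearly on the lift, so continuity of the frame follows
       from that of the lift. *)
    have f_lin : linear (fun u : quat A * quat A => frame u (theta u) ab).
      move=> k u v; rewrite /frame scal_linearl -!theta_scal scal_linearl.
      by rewrite theta_linear scalerDr addrACA.
    have [psi psiE] := comp_form f_lin phi.
    rewrite (_ : (fun t => _) = fun t => psi (eigen_lift y t)).
      exact: smooth_near0_continuous (eigen_lift_smooth y).
    by apply/funext => t; rewrite psiE.
  have [J_quat _] := CGJ.
  rewrite y0; apply/bij_inj/(eigen_frame_bij J_quat ee) => //.
  by move: Fy; rewrite eigenline.
have [_ c_CG _ _] := cL.
near=> t.
have CGt : CG s (c t) by near: t.
have yt_inj : injective (scal (eigen_lift y t)).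
  have T_inj : injective (frame (eigen_lift y t) (theta (eigen_lift y t))).
    by near: t.
  move=> a a' aa'; have := T_inj (a, 0) (a', 0).
  by rewrite /frame /= !scal0 aa' => /(_ erefl) [].
have Jyt : KH (c t) (eigen_lift y t) = e *: eigen_lift y t.
  have : F (c t) (eigen_lift y t) by near: t; exact: eigen_lift_mem.
  by rewrite eigenline.
have [c_quat _] := CGt.
split; last by rewrite /= eigenline // (line_eigenE c_quat ee).
by exists (theta (eigen_lift y t)); exact: (eigen_frame_bij c_quat ee).
Unshelve. all: by end_near. Qed.

(* Differentiating K_t y(t) = e y(t) gives K_L y + K_J w = e w, so that
   w - (e/2) K_L y = (w + e K_J w) / 2 is the projection of w to F J. *)
Lemma lift_velocity y w :
    (\forall t \near (0 : R), F (c t) (y t)) -> has_velocity y w ->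
  F J (w - (e / 2) *: KH L (y 0)).
Proof.
move=> Fy yw; have [_ c_CG c0 cv] := cL.
have JLw : KH L (y 0) + KH J w = e *: w.
  rewrite -[X in KH X w]c0.
  have e_lin : linear (fun v : quat A * quat A => e *: v).
    by move=> k u v; rewrite scalerDr !scalerA mulrC.
  apply: (has_velocity_uniq
    (has_velocity_bilinear (@KH_linearl _ _) (@KH_linear _ _) cv yw)
    (has_velocity_linear e_lin yw)).
  by apply: filterS2 c_CG Fy => t CGt; rewrite eigenline.
have [J_quat _] := CGJ.
rewrite eigenline // (_ : _ - _ = 2^-1 *: w + (e / 2) *: KH J w).
  exact: eigen_proj.
rewrite -[KH L _](addrK (KH J w)) JLw scalerBr opprB scalerA mulrAC ee.
rewrite addrCA addrC; congr (_ + _).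
by rewrite -{1}[w]scale1r -scalerBl {1}[1]splitr addrK div1r.
Qed.

Lemma omegaH_velocity v : anti_involution s -> F J v ->
  omegaH s ((e / 2) *: KH L v) v + omegaH s v ((e / 2) *: KH L v) = 0.
Proof.
move=> inv_s Fv; have vv := eigen_lift_velocity v.
(* The two copies of [v] outside [KH L v] become values of the lift at 0, which is the shape the
   product rule produces. *)
rewrite -{2 3}(eigen_lift0 Fv).
apply: (has_velocity_uniq
  (has_velocity_bilinear (omegaH_linearl s) (omegaH_linearr s) vv vv)
  (has_velocity_cst 0)).
have [_ c_CG _ _] := cL.
by apply: filterS2 c_CG (eigen_lift_mem v) => t CGt Fvt;
  exact: (eigenline_isotropic inv_s CGt).
Qed.

End Eigenlines.

Theorem proposition7p11 (R : realType) (A : falgType R) (s : {linear A -> A})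
  (ssA : semisimple A) (inv_s : anti_involution s)
  (herm_s : hermitian_algebra s)
  (b : bool)
  (F : {fun CG s >-> PG s b})
  (FE : forall J, CG s J ->
     exists y : quat A * quat A,
       [/\ regular y, extH J y = (-1) ^+ (~~ b) *: scal y jH & F J = line y])
  (J L : 'End((cplx A * cplx A)%type)) (CGJ : CG s J) (TL : tangentC s J L)
  (x : quat A * quat A) (xJ : F J = line x)
  (Jx : extH J x = (-1) ^+ (~~ b) *: scal x jH) :
  let w v := ((-1) ^+ b / 2) *: scal (extH L v) jH in
  [/\ is_differential s F J L (bracket x (w x)),
      forall v, F J v -> bracket x (w x) v = coset_mod (F J) (w v)
    & tangentP s (F J) (bracket x (w x))].
Proof.
set e : R := (-1) ^+ b => w.
have wE v : w v = (e / 2) *: KH L v by [].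
have ee : e * e = 1 by rewrite -expr2 sqrr_sign.
(* The sign in J_H(y) = -e y j is opposite to that of P_G; the eigenvalue of K_J is then e. *)
have eN : (-1) ^+ (~~ b) = - e by rewrite signrN.
rewrite eN in FE.
have [c0 c0L] := TL.
have L_anti : antilinear L.
  have [_ c_CG _ cv] := c0L; apply: antilinear_velocity cv _.
  by apply: filterS c_CG => t [[]].
have w_scal v a : w (scal v a) = scal (w v) a by rewrite !wE KH_scal ?scalZl.
have wD u v : w (u + v) = w u + w v by rewrite !wE KHD scalerDr.
have bracket_w v : F J v -> bracket x (w x) v = coset_mod (F J) (w v).
  rewrite xJ => xv; apply: bracketE => // a.
  by rewrite w_scal subrr; exists 0; rewrite scal0.
split=> //.
- split=> // c cL; split.
    have [y [y_reg Jy Fy]] := FE _ CGJ; exists (eigen_lift e c y).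
    apply: (eigen_lift_is_lift ee FE CGJ cL); first exact: regular_inj.
    by rewrite Fy; exact: line_id.
  (* An arbitrary lift may start at a generator [y 0] other than [x]; the two brackets are compared
     through [w], which is tied to no generator. *)
  move=> y v [_ y_line] yv u; have [_ _ c00 _] := cL; rewrite /= c00 => Fu.
  have [_ /= Fy0] := nbhs_singleton y_line; rewrite c00 in Fy0.
  rewrite bracket_w //; rewrite Fy0 in Fu *.
  rewrite (bracketE (W := w)) // => a; rewrite w_scal -scalBl.
  apply: line_scal; rewrite -Fy0.
  apply: (lift_velocity ee FE CGJ cL) => //.
  by apply: filterS y_line => t [_ /= ->]; exact: line_id.
- split.
    rewrite xJ; apply: (is_hom_coset wD w_scal) => v; rewrite -xJ.
    exact: bracket_w.
  move=> y v Fy; have FJy : F J y by rewrite Fy; exact: line_id.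
  rewrite bracket_w // => -[z Fz <-]; rewrite /sym /=.
  (* Isotropy of [F J] removes the ambiguity [z] of the representative, leaving the condition for
     [w y] alone. *)
  have zy : omegaH s z y = 0 by exact: (eigenline_isotropic inv_s CGJ Fz FJy).
  have wzy : omegaH s (w y + z) y = omegaH s (w y) y.
    by have := omegaH_linearl s y 1 (w y) z; rewrite /= !scale1r zy addr0.
  rewrite wzy s0_omegaH //; apply/esym/eqP; rewrite -addr_eq0.
  by rewrite wE (omegaH_velocity ee FE CGJ c0L).
Qed.
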